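(* $\mathrm{CON}(\mathrm{THT}^{0})$ is PSPACE-hard.
   Context: Fix a finite set $P$ of atomic propositions. THT formulas over $P$: $\varphi ::= p \mid \bot \mid \varphi\vee\varphi \mid \varphi\wedge\varphi \mid \varphi\rightarrow\varphi \mid \mathsf{X}\varphi \mid \varphi\,\mathsf{U}\,\varphi \mid \varphi\,\mathsf{R}\,\varphi$, plus the modalities $\mathsf F\varphi$ and $\mathsf G\varphi$ with the meaning of $\top\mathsf U\varphi$ and $\bot\mathsf R\varphi$. A THT interpretation is a pair $M=(H,T)$ of infinite words over $2^P$ with $H(i)\subseteq T(i)$ for all $i$; it is total if $H=T$. Satisfaction $M,i\models\varphi$ is defined by: - $M,i\not\models\bot$; - $M,i\models p$ iff $p\in H(i)$; - $\vee$ and $\wedge$ are interpreted as usual; - $M,i\models\varphi\rightarrow\psi$ iff for both $H'\in\{H,T\}$, either $(H',T),i\not\models\varphi$ or $(H',T),i\models\psi$; - the temporal modalities have their usual LTL clauses evaluated in $M$. $M\models\varphi$ means $M,0\models\varphi$. An equilibrium model of $\varphi$ is a total $(T,T)\models\varphi$ such that $(H,T)\not\models\varphi$ whenever $H(i)\subseteq T(i)$ for all $i$ and $H\ne T$. $\mathrm{THT}^0$ is the set of THT formulas containing no implication (hence no negation); all temporal modalities are allowed. $\mathrm{CON}(\mathrm{THT}^0)$ is the problem of deciding whether a given $\mathrm{THT}^0$ formula has an equilibrium model. *)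

(* Defs.v *)
From Stdlib Require Import List Arith PArith.
Import ListNotations.

Inductive tht : Type :=
| Atom : nat -> tht
| Bot  : tht
| Or   : tht -> tht -> tht
| And  : tht -> tht -> tht
| Impl : tht -> tht -> tht
| Next : tht -> tht
| Until : tht -> tht -> tht
| Release : tht -> tht -> tht
| Fin : tht -> tht
| Glob : tht -> tht.

(* infinite words over 2^P: position -> atom -> membership *)
Definition trace := nat -> nat -> bool.

Fixpoint sat (H T : trace) (i : nat) (phi : tht) {struct phi} : Prop :=
  match phi with
  | Atom p => H i p = true
  | Bot => False
  | Or a b => sat H T i a \/ sat H T i b
  | And a b => sat H T i a /\ sat H T i b
  | Impl a b => (sat H T i a -> sat H T i b) /\ (sat T T i a -> sat T T i b)
  | Next a => sat H T (S i) a
  | Until a b => exists k, i <= k /\ sat H T k b /\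
                   forall j, i <= j -> j < k -> sat H T j a
  | Release a b => forall k, i <= k ->
                   sat H T k b \/ exists j, i <= j /\ j < k /\ sat H T j a
  | Fin a => exists k, i <= k /\ sat H T k a
  | Glob a => forall k, i <= k -> sat H T k a
  end.

Definition below (H T : trace) : Prop :=
  forall i p, H i p = true -> T i p = true.

Definition equilibrium_model (T : trace) (phi : tht) : Prop :=
  sat T T 0 phi /\
  forall H : trace, below H T -> (exists i p, H i p <> T i p) -> ~ sat H T 0 phi.

Fixpoint impl_free (phi : tht) : Prop :=
  match phi with
  | Atom _ | Bot => True
  | Or a b | And a b | Until a b | Release a b => impl_free a /\ impl_free b
  | Impl _ _ => False
  | Next a | Fin a | Glob a => impl_free a
  end.

Fixpoint pbits (p : positive) : list bool :=
  match p with
  | xH => []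
  | xO q => false :: pbits q
  | xI q => true :: pbits q
  end.

(* self-delimiting binary code of a natural number *)
Definition enc_nat (n : nat) : list bool :=
  flat_map (fun b => [true; b]) (pbits (Pos.of_succ_nat n)) ++ [false].

Fixpoint enc (phi : tht) : list bool :=
  match phi with
  | Atom n => [false;false;false;false] ++ enc_nat n
  | Bot => [false;false;false;true]
  | Or a b => [false;false;true;false] ++ enc a ++ enc b
  | And a b => [false;false;true;true] ++ enc a ++ enc b
  | Impl a b => [false;true;false;false] ++ enc a ++ enc b
  | Next a => [false;true;false;true] ++ enc a
  | Until a b => [false;true;true;false] ++ enc a ++ enc b
  | Release a b => [false;true;true;true] ++ enc a ++ enc b
  | Fin a => [true;false;false;false] ++ enc a
  | Glob a => [true;false;false;true] ++ enc a
  end.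

Definition language := list bool -> Prop.

Definition CON_THT0 : language :=
  fun w => exists phi, enc phi = w /\ impl_free phi /\ exists T, equilibrium_model T phi.

Inductive sym : Type := Blank | Zero | One.
Inductive move : Type := MoveL | MoveR | Stay.

Definition sym_of_bool (b : bool) : sym := if b then One else Zero.

Record TM : Type := {
  nstates : nat;
  delta : nat -> sym -> nat * sym * move;
  q_start : nat;
  q_acc : nat;
  q_rej : nat
}.

Definition TM_wf (M : TM) : Prop :=
  q_start M < nstates M /\ q_acc M < nstates M /\ q_rej M < nstates M /\
  q_acc M <> q_rej M /\
  forall q s, q < nstates M -> fst (fst (delta M q s)) < nstates M.

(* configuration: state, cells left of the head (nearest first),
   the scanned cell, cells right of the head *)
Record config : Type := Cfg {
  c_state : nat; c_left : list sym; c_cur : sym; c_right : list sym }.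

Definition halted (M : TM) (c : config) : Prop :=
  c_state c = q_acc M \/ c_state c = q_rej M.

Definition step (M : TM) (c : config) : config :=
  let q := c_state c in
  if orb (Nat.eqb q (q_acc M)) (Nat.eqb q (q_rej M)) then c else
  match delta M q (c_cur c) with
  | (q', s', MoveL) =>
      match c_left c with
      | [] => Cfg q' [] s' (c_right c)
      | x :: l => Cfg q' l x (s' :: c_right c)
      end
  | (q', s', MoveR) =>
      match c_right c with
      | [] => Cfg q' (s' :: c_left c) Blank []
      | x :: r => Cfg q' (s' :: c_left c) x r
      end
  | (q', s', Stay) => Cfg q' (c_left c) s' (c_right c)
  end.

Definition run (M : TM) (t : nat) (c : config) : config := Nat.iter t (step M) c.

Definition init (M : TM) (w : list bool) : config :=
  match map sym_of_bool w with
  | [] => Cfg (q_start M) [] Blank []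
  | x :: r => Cfg (q_start M) [] x r
  end.

Definition space (c : config) : nat := length (c_left c) + 1 + length (c_right c).

Definition poly_bound (p : nat -> nat) : Prop :=
  exists k d, forall n, p n <= d * n ^ k + d.

Definition PSPACE (L : language) : Prop :=
  exists (M : TM) (p : nat -> nat), TM_wf M /\ poly_bound p /\
    forall w,
      (exists t, halted M (run M t (init M w)) /\
                 (c_state (run M t (init M w)) = q_acc M <-> L w)) /\
      (forall t, space (run M t (init M w)) <= p (length w)).

Definition poly_time_computable (f : list bool -> list bool) : Prop :=
  exists (M : TM) (p : nat -> nat), TM_wf M /\ poly_bound p /\
    forall w, exists t, t <= p (length w) /\
      let c := run M t (init M w) in
      c_state c = q_acc M /\
      exists rest, c_cur c :: c_right c = map sym_of_bool (f w) ++ rest /\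
                   forall s, In s rest -> s = Blank.

Definition poly_reduces (L L' : language) : Prop :=
  exists f, poly_time_computable f /\ forall w, L w <-> L' (f w).

Definition PSPACE_hard (L' : language) : Prop :=
  forall L, PSPACE L -> poly_reduces L L'.

(* Main.v *)
From Stdlib Require Import List Arith PArith Lia Classical.
Require Import Defs.
Import ListNotations.

(** An implication-free formula only looks at [H], so its equilibrium models are
    its minimal LTL models.  A run of a space-bounded machine is written as an
    infinite word, one tape cell per time point and one atom per letter; all
    configurations have the same length [L - 1], so the letter [L + 1] steps
    ahead is determined by three consecutive letters.  The reduction requires
    some letter at every time point and, infinitely often, either two letters at
    once or the start of an accepting computation.  If the machine accepts,
    repeating the accepting computation forever with exactly one letter at each
    point is a minimal model.  Conversely a model with infinitely many double
    letters is never minimal, since one of them can be dropped, and any other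
    model has a suffix with unique letters in which a genuine accepting
    computation starts.

    The formula depends on the input only through the word itself and through
    unary blocks of polynomial length.  A one-tape machine writes it with loops
    nested over separate copies of the input. *)

(** * While programs on a tape and their compilation *)

Definition tape : Type := (list sym * sym * list sym)%type.

Definition cur (tp : tape) : sym := snd (fst tp).

Definition act (a : sym * move) (tp : tape) : tape :=
  let '(l, _, r) := tp in
  match a with
  | (s, MoveL) => match l with [] => ([], s, r) | x :: l' => (l', x, s :: r) end
  | (s, MoveR) => match r with [] => (s :: l, Blank, []) | x :: r' => (s :: l, x, r') end
  | (s, Stay) => (l, s, r)
  end.

Inductive prog : Type :=
| Act : (sym -> sym * move) -> prog
| Seq : prog -> prog -> prog
| If : (sym -> bool) -> prog -> prog -> prog
| While : (sym -> bool) -> prog -> prog.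

Inductive exec : prog -> tape -> tape -> nat -> Prop :=
| exec_act f tp : exec (Act f) tp (act (f (cur tp)) tp) 1
| exec_seq p q tp1 tp2 tp3 t1 t2 :
    exec p tp1 tp2 t1 -> exec q tp2 tp3 t2 -> exec (Seq p q) tp1 tp3 (t1 + t2)
| exec_if_true b p q tp1 tp2 t :
    b (cur tp1) = true -> exec p tp1 tp2 t -> exec (If b p q) tp1 tp2 (S t)
| exec_if_false b p q tp1 tp2 t :
    b (cur tp1) = false -> exec q tp1 tp2 t -> exec (If b p q) tp1 tp2 (S t)
| exec_while_true b p tp1 tp2 tp3 t1 t2 :
    b (cur tp1) = true -> exec p tp1 tp2 t1 -> exec (While b p) tp2 tp3 t2 ->
    exec (While b p) tp1 tp3 (S (t1 + t2))
| exec_while_false b p tp : b (cur tp) = false -> exec (While b p) tp tp 1.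

Fixpoint size (p : prog) : nat :=
  match p with
  | Act _ => 1
  | Seq p q => size p + size q
  | If _ p q => S (size p + size q)
  | While _ p => S (size p)
  end.

(* The code of [p] occupies the states [o .. o + size p - 1] and leaves through [e]. *)
Fixpoint comp (p : prog) (o e x : nat) (s : sym) : nat * sym * move :=
  match p with
  | Act f => (e, fst (f s), snd (f s))
  | Seq p q => if x <? o + size p then comp p o (o + size p) x s
               else comp q (o + size p) e x s
  | If b p q => if x =? o then ((if b s then S o else S o + size p), s, Stay)
                else if x <? S o + size p then comp p (S o) e x s
                else comp q (S o + size p) e x s
  | While b p => if x =? o then ((if b s then S o else e), s, Stay)
                 else comp p (S o) o x s
  end.

Lemma size_pos p : 0 < size p.
Proof. induction p; simpl; lia. Qed.

Lemma comp_bound p : forall o e x s n, o + size p <= n -> e < n ->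
  fst (fst (comp p o e x s)) < n.
Proof.
  induction p; intros o e x s n Hn He; simpl in *.
  - exact He.
  - pose proof (size_pos p2).
    destruct (x <? o + size p1); [apply IHp1|apply IHp2]; lia.
  - pose proof (size_pos p1). pose proof (size_pos p2).
    destruct (x =? o); simpl; [destruct (b s); lia|].
    destruct (x <? _); [apply IHp1|apply IHp2]; lia.
  - pose proof (size_pos p).
    destruct (x =? o); simpl; [destruct (b s); lia|]. apply IHp; lia.
Qed.

Definition cfg (q : nat) (tp : tape) : config :=
  Cfg q (fst (fst tp)) (snd (fst tp)) (snd tp).

Lemma run_add M t1 t2 c : run M (t1 + t2) c = run M t2 (run M t1 c).
Proof. unfold run. rewrite Nat.add_comm. apply Nat.iter_add. Qed.

Lemma run_succ M t c : run M (S t) c = run M t (step M c).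
Proof. apply (run_add M 1 t c). Qed.

Lemma step_cfg M q tp q' s' m :
  q <> q_acc M -> q <> q_rej M -> delta M q (cur tp) = (q', s', m) ->
  step M (cfg q tp) = cfg q' (act (s', m) tp).
Proof.
  intros Ha Hr Hd. destruct tp as [[l u] r]. unfold step, cfg, cur in *. simpl in *.
  apply Nat.eqb_neq in Ha, Hr. rewrite Ha, Hr, Hd. simpl.
  destruct m; [destruct l|destruct r|]; reflexivity.
Qed.

(** [M] is arbitrary and need only agree with [comp] on the interval of the code, so the induction
    applies to subprograms inside a larger machine. The time is exact because [exec] charges one
    step for each test and each action. *)
Lemma comp_exec M p tp tp' t : exec p tp tp' t -> forall o e,
  (forall x s, o <= x < o + size p -> delta M x s = comp p o e x s) ->
  (forall x, o <= x < o + size p -> x <> q_acc M /\ x <> q_rej M) ->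
  run M t (cfg o tp) = cfg e tp'.
Proof.
  induction 1; intros o e Hd Hh; simpl in Hd, Hh.
  - rewrite run_succ. destruct (Hh o) as [H1 H2]; [lia|].
    rewrite (step_cfg M o tp e (fst (f (cur tp))) (snd (f (cur tp)))); auto.
    + rewrite <- surjective_pairing. reflexivity.
    + apply Hd. lia.
  - pose proof (size_pos p). pose proof (size_pos q).
    rewrite run_add, (IHexec1 o (o + size p)), (IHexec2 (o + size p) e); auto.
    + intros x s Hx. rewrite Hd by lia. destruct (Nat.ltb_spec x (o + size p)); [lia|auto].
    + intros x Hx. apply Hh. lia.
    + intros x s Hx. rewrite Hd by lia. destruct (Nat.ltb_spec x (o + size p)); [auto|lia].
    + intros x Hx. apply Hh. lia.
  - rewrite run_succ. destruct (Hh o) as [H1 H2]; [lia|].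
    rewrite (step_cfg M o tp1 (S o) (cur tp1) Stay); auto.
    + replace (act (cur tp1, Stay) tp1) with tp1 by (destruct tp1 as [[? ?] ?]; reflexivity).
      apply IHexec.
      * intros x s Hx. rewrite Hd by lia.
        destruct (Nat.eqb_spec x o); [lia|].
        destruct (Nat.ltb_spec x (S (o + size p))); [auto|lia].
      * intros x Hx. apply Hh. lia.
    + rewrite Hd, Nat.eqb_refl, H by lia. reflexivity.
  - rewrite run_succ. destruct (Hh o) as [H1 H2]; [lia|].
    rewrite (step_cfg M o tp1 (S o + size p) (cur tp1) Stay); auto.
    + replace (act (cur tp1, Stay) tp1) with tp1 by (destruct tp1 as [[? ?] ?]; reflexivity).
      apply IHexec.
      * intros x s Hx. rewrite Hd by lia.
        destruct (Nat.eqb_spec x o); [lia|].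
        destruct (Nat.ltb_spec x (S (o + size p))); [lia|auto].
      * intros x Hx. apply Hh. lia.
    + rewrite Hd, Nat.eqb_refl, H by lia. reflexivity.
  - rewrite run_succ, run_add. destruct (Hh o) as [H3 H4]; [lia|].
    rewrite (step_cfg M o tp1 (S o) (cur tp1) Stay); auto.
    + replace (act (cur tp1, Stay) tp1) with tp1 by (destruct tp1 as [[? ?] ?]; reflexivity).
      (* The body exits through [o], the state of the loop test, where the remaining iterations
         start. *)
      rewrite (IHexec1 (S o) o).
      * apply IHexec2; auto.
      * intros x s Hx. rewrite Hd by lia. destruct (Nat.eqb_spec x o); [lia|auto].
      * intros x Hx. apply Hh. lia.
    + rewrite Hd, Nat.eqb_refl, H by lia. reflexivity.
  - rewrite run_succ. destruct (Hh o) as [H3 H4]; [lia|].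
    rewrite (step_cfg M o tp e (cur tp) Stay); auto.
    + destruct tp as [[? ?] ?]; reflexivity.
    + rewrite Hd, Nat.eqb_refl, H by lia. reflexivity.
Qed.

Definition machine (p : prog) : TM := {|
  nstates := size p + 2;
  delta := comp p 0 (size p);
  q_start := 0;
  q_acc := size p;
  q_rej := S (size p) |}.

Lemma machine_wf p : TM_wf (machine p).
Proof.
  unfold TM_wf, machine; simpl. repeat split; try lia.
  intros q s _. apply comp_bound; lia.
Qed.

Lemma machine_run p tp tp' t : exec p tp tp' t ->
  run (machine p) t (cfg 0 tp) = cfg (size p) tp'.
Proof.
  intros H. apply (comp_exec (machine p) p tp tp' t H); simpl; intros; auto; lia.
Qed.

(** * Polynomial bounds *)

Lemma poly_bound_le f g : (forall n, f n <= g n) -> poly_bound g -> poly_bound f.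
Proof. intros H [k [d Hg]]. exists k, d. intros n. specialize (H n). specialize (Hg n). lia. Qed.

Lemma poly_bound_const c : poly_bound (fun _ => c).
Proof. exists 0, c. intros n. simpl. lia. Qed.

Lemma poly_bound_id : poly_bound (fun n => n).
Proof. exists 1, 1. intros n. simpl. lia. Qed.

(** The [+ 1] covers [n = 0] and [j = 0], where the left side is 1 and the power on the right may
    vanish. *)
Lemma pow_le_add n j k : n ^ j <= n ^ (j + k) + 1.
Proof.
  destruct (Nat.eq_dec n 0) as [->|Hn].
  - destruct j; simpl; [lia|]. lia.
  - pose proof (Nat.pow_le_mono_r n j (j + k) Hn). lia.
Qed.

Lemma poly_bound_add f g : poly_bound f -> poly_bound g -> poly_bound (fun n => f n + g n).
Proof.
  intros [k1 [d1 H1]] [k2 [d2 H2]]. exists (k1 + k2), (2 * d1 + 2 * d2). intros n.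
  pose proof (pow_le_add n k1 k2). pose proof (pow_le_add n k2 k1) as H0.
  rewrite (Nat.add_comm k2 k1) in H0.
  specialize (H1 n). specialize (H2 n). nia.
Qed.

Lemma poly_bound_mul f g : poly_bound f -> poly_bound g -> poly_bound (fun n => f n * g n).
Proof.
  (* The 4 counts the monomials of [(n ^ k1 + 1) * (n ^ k2 + 1)], each at most
     [n ^ (k1 + k2) + 1]. *)
  intros [k1 [d1 H1]] [k2 [d2 H2]]. exists (k1 + k2), (4 * d1 * d2). intros n.
  pose proof (pow_le_add n k1 k2) as Ha. pose proof (pow_le_add n k2 k1) as Hb.
  rewrite (Nat.add_comm k2 k1) in Hb.
  specialize (H1 n). specialize (H2 n).
  assert (Hc : f n * g n <= (d1 * n ^ k1 + d1) * (d2 * n ^ k2 + d2)) by (apply Nat.mul_le_mono; lia).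
  assert (Hd : n ^ k1 * n ^ k2 = n ^ (k1 + k2)) by (rewrite Nat.pow_add_r; reflexivity).
  assert (He : (d1 * n ^ k1 + d1) * (d2 * n ^ k2 + d2)
     = d1 * d2 * (n ^ k1 * n ^ k2 + n ^ k1 + n ^ k2 + 1)) by ring.
  rewrite He, Hd in Hc.
  assert (n ^ (k1 + k2) + n ^ k1 + n ^ k2 + 1 <= 4 * n ^ (k1 + k2) + 4 - 1) by lia.
  assert (d1 * d2 * (n ^ (k1 + k2) + n ^ k1 + n ^ k2 + 1) <= d1 * d2 * (4 * n ^ (k1 + k2) + 4))
    by (apply Nat.mul_le_mono_l; lia).
  replace (4 * d1 * d2 * n ^ (k1 + k2) + 4 * d1 * d2)
    with (d1 * d2 * (4 * n ^ (k1 + k2) + 4)) by ring.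
  lia.
Qed.

Lemma poly_bound_pow f k : poly_bound f -> poly_bound (fun n => f n ^ k).
Proof.
  intros Hf. induction k as [|k IH]; simpl.
  - apply poly_bound_const.
  - apply (poly_bound_mul f (fun n => f n ^ k)); assumption.
Qed.

(** For positive [m] one has [m + 1 <= 2 * m]. This turns a bound in the length of an input into one
    in the length of its tail. *)
Lemma pow_succ_bound m k : (m + 1) ^ k <= 2 ^ k * m ^ k + 1.
Proof.
  destruct m as [|m].
  - rewrite Nat.pow_1_l. lia.
  - rewrite <- Nat.pow_mul_l.
    pose proof (Nat.pow_le_mono_l (S m + 1) (2 * S m) k). lia.
Qed.

(** * Words separated by blanks *)

Definition nonblank (s : sym) : bool := match s with Blank => false | _ => true end.
Definition is_one (s : sym) : bool := match s with One => true | _ => false end.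

Notation syms := (map sym_of_bool).

Lemma nonblank_sym b : nonblank (sym_of_bool b) = true.
Proof. destruct b; reflexivity. Qed.

Definition move_by (m : move) : prog := Act (fun s => (s, m)).
Definition write (s : sym) (m : move) : prog := Act (fun _ => (s, m)).

Lemma exec_act_eq f tp tp' : act (f (cur tp)) tp = tp' -> exec (Act f) tp tp' 1.
Proof. intros <-. constructor. Qed.

Definition prev_blank : prog := Seq (move_by MoveL) (While nonblank (move_by MoveL)).
Definition next_blank : prog := Seq (move_by MoveR) (While nonblank (move_by MoveR)).

(** A tape keeps the scanned cell apart from the left list; the equation on [c :: l0] treats empty
    and nonempty [u] alike. *)
Lemma scan_left u : forall l0 c l r, c :: l0 = syms u ++ Blank :: l ->
  exec (While nonblank (move_by MoveL)) (l0, c, r) (l, Blank, rev (syms u) ++ r) (2 * length u + 1).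
Proof.
  induction u as [|b u IH]; simpl; intros l0 c l r E.
  - injection E as -> ->. constructor. reflexivity.
  - injection E as -> ->.
    destruct (syms u ++ Blank :: l) as [|c' l'] eqn:E; [destruct u; discriminate|].
    replace (length u + S (length u + 0) + 1) with (1 + (2 * length u + 1)) by lia.
    apply exec_while_true with (tp2 := (l', c', sym_of_bool b :: r)).
    + apply nonblank_sym.
    + apply exec_act_eq. reflexivity.
    + rewrite <- app_assoc. simpl. apply IH. auto.
Qed.

Lemma scan_right u : forall r0 c l r, c :: r0 = syms u ++ Blank :: r ->
  exec (While nonblank (move_by MoveR)) (l, c, r0) (rev (syms u) ++ l, Blank, r) (2 * length u + 1).
Proof.
  induction u as [|b u IH]; simpl; intros r0 c l r E.
  - injection E as -> ->. constructor. reflexivity.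
  - injection E as -> ->.
    destruct (syms u ++ Blank :: r) as [|c' r'] eqn:E; [destruct u; discriminate|].
    replace (length u + S (length u + 0) + 1) with (1 + (2 * length u + 1)) by lia.
    apply exec_while_true with (tp2 := (sym_of_bool b :: l, c', r')).
    + apply nonblank_sym.
    + apply exec_act_eq. reflexivity.
    + rewrite <- app_assoc. simpl. apply IH. auto.
Qed.

Lemma exec_prev_blank u l s r :
  exec prev_blank (syms u ++ Blank :: l, s, r) (l, Blank, rev (syms u) ++ s :: r) (2 * length u + 2).
Proof.
  destruct (syms u ++ Blank :: l) as [|c l0] eqn:E; [destruct u; discriminate|].
  replace (2 * length u + 2) with (1 + (2 * length u + 1)) by lia.
  apply exec_seq with (tp2 := (l0, c, s :: r)).
  - apply exec_act_eq. reflexivity.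
  - apply scan_left. auto.
Qed.

Lemma exec_next_blank u l s r :
  exec next_blank (l, s, syms u ++ Blank :: r) (rev (syms u) ++ s :: l, Blank, r) (2 * length u + 2).
Proof.
  destruct (syms u ++ Blank :: r) as [|c r0] eqn:E; [destruct u; discriminate|].
  replace (2 * length u + 2) with (1 + (2 * length u + 1)) by lia.
  apply exec_seq with (tp2 := (s :: l, c, r0)).
  - apply exec_act_eq. reflexivity.
  - apply scan_right. auto.
Qed.

(* The tape beyond the last cell of the list representation reads [Blank]. *)
Lemma exec_next_blank_end u l s :
  exec next_blank (l, s, syms u) (rev (syms u) ++ s :: l, Blank, []) (2 * length u + 2).
Proof.
  (* Either the closing blank is already present, or the scan starts on a letter and creates that
     blank by leaving the list. *)
  assert (H : forall u l c r0, c :: r0 = syms u ++ [Blank] \/ (u <> [] /\ c :: r0 = syms u) ->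
    exec (While nonblank (move_by MoveR)) (l, c, r0) (rev (syms u) ++ l, Blank, []) (2 * length u + 1)).
  { clear. intros u l c r0 [H|[Hu H]]; [apply scan_right; exact H|].
    revert l c r0 Hu H. induction u as [|b u IH]; intros l c r0 Hu H; [congruence|].
    simpl in H. injection H as -> ->. simpl length.
    replace (2 * S (length u) + 1) with (S (1 + (2 * length u + 1))) by lia.
    simpl rev. rewrite <- app_assoc. destruct u as [|b' u].
    - apply exec_while_true with (tp2 := (sym_of_bool b :: l, Blank, [])).
      + apply nonblank_sym.
      + apply exec_act_eq. reflexivity.
      + constructor. reflexivity.
    - apply exec_while_true with (tp2 := (sym_of_bool b :: l, sym_of_bool b', syms u)).
      + apply nonblank_sym.
      + apply exec_act_eq. reflexivity.
      + apply IH; [discriminate|reflexivity]. }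
  replace (2 * length u + 2) with (1 + (2 * length u + 1)) by lia.
  destruct u as [|b u].
  - apply exec_seq with (tp2 := (s :: l, Blank, [])).
    + apply exec_act_eq. reflexivity.
    + apply (H []). left. reflexivity.
  - apply exec_seq with (tp2 := (s :: l, sym_of_bool b, syms u)).
    + apply exec_act_eq. reflexivity.
    + apply (H (b :: u)). right. split; [discriminate|reflexivity].
Qed.

(* [lay rs L] is a tape to the left of the head, and [lay_right rs R] a tape to
   its right, holding the words [rs], each closed by a blank; the first word of
   [rs] is the rightmost one in both cases. *)
Fixpoint lay (rs : list (list bool)) (L : list sym) : list sym :=
  match rs with
  | [] => L
  | u :: rs => syms (rev u) ++ Blank :: lay rs L
  end.

Fixpoint lay_right (rs : list (list bool)) (R : list sym) : list sym :=
  match rs with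
  | [] => R
  | u :: rs => lay_right rs (syms u ++ Blank :: R)
  end.

Lemma lay_app rs rs' L : lay (rs ++ rs') L = lay rs (lay rs' L).
Proof. induction rs as [|u rs IH]; simpl; [reflexivity|]. rewrite IH. reflexivity. Qed.

Lemma lay_right_app rs rs' R : lay_right (rs ++ rs') R = lay_right rs' (lay_right rs R).
Proof. revert R. induction rs as [|u rs IH]; intros R; simpl; auto. Qed.

Fixpoint prev_blanks (n : nat) : prog :=
  match n with 0 => move_by Stay | S n => Seq prev_blank (prev_blanks n) end.
(** Nested to the left, unlike [prev_blanks]: the first word of the list is the rightmost, hence the
    last one crossed on the way right. *)
Fixpoint next_blanks (n : nat) : prog :=
  match n with 0 => move_by Stay | S n => Seq (next_blanks n) next_blank end.

Fixpoint nav_time (rs : list (list bool)) : nat :=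
  match rs with [] => 1 | u :: rs => 2 * length u + 2 + nav_time rs end.

(** Each side counts its own final [Stay], whence the [+ 1]. *)
Lemma nav_time_app rs rs' : nav_time (rs ++ rs') + 1 = nav_time rs + nav_time rs'.
Proof. induction rs as [|u rs IH]; simpl in *; lia. Qed.

Lemma rev_syms_rev u : rev (syms (rev u)) = syms u.
Proof. rewrite map_rev, rev_involutive. reflexivity. Qed.

Lemma exec_prev_blanks rs : forall n L R, n = length rs ->
  exec (prev_blanks n) (lay rs L, Blank, R) (L, Blank, lay_right rs R) (nav_time rs).
Proof.
  induction rs as [|u rs IH]; intros n L R ->.
  - apply exec_act_eq. reflexivity.
  - cbn [length prev_blanks lay lay_right nav_time].
    eapply exec_seq; [|apply IH; reflexivity].
    pose proof (exec_prev_blank (rev u) (lay rs L) Blank R) as H.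
    rewrite rev_syms_rev, length_rev in H. exact H.
Qed.

Lemma exec_next_blanks rs : forall n L R, n = length rs ->
  exec (next_blanks n) (L, Blank, lay_right rs R) (lay rs L, Blank, R) (nav_time rs).
Proof.
  induction rs as [|u rs IH]; intros n L R ->.
  - apply exec_act_eq. reflexivity.
  - cbn [length next_blanks lay lay_right nav_time].
    rewrite (Nat.add_comm _ (nav_time rs)).
    eapply exec_seq; [apply IH; reflexivity|].
    rewrite map_rev. apply exec_next_blank.
Qed.

(* [n] bounds the length of the output word, the rightmost one on the tape. *)
Definition appends (n : nat) (rs : list (list bool)) (p : prog) (g : list bool) (time : nat) : Prop :=
  forall L out z, length (out ++ g) <= n -> exists z' t,
    exec p (lay (out :: rs) L, Blank, repeat Blank z)
           (lay ((out ++ g) :: rs) L, Blank, repeat Blank z') t /\ t <= time.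

Lemma appends_le n rs p g t t' : appends n rs p g t -> t <= t' -> appends n rs p g t'.
Proof.
  intros H Ht L out z Hn. destruct (H L out z Hn) as [z' [t0 [He Hle]]].
  exists z', t0. split; [assumption|lia].
Qed.

Lemma appends_nil n rs : appends n rs (move_by Stay) [] 1.
Proof.
  intros L out z _. exists z, 1. split; [|lia]. rewrite app_nil_r.
  apply exec_act_eq. reflexivity.
Qed.

Lemma appends_seq n rs p q g h t1 t2 :
  appends n rs p g t1 -> appends n rs q h t2 -> appends n rs (Seq p q) (g ++ h) (t1 + t2).
Proof.
  intros Hp Hq L out z Hn. rewrite app_assoc in *.
  destruct (Hp L out z) as [z1 [s1 [E1 L1]]]; [rewrite !length_app in *; lia|].
  destruct (Hq L (out ++ g) z1 Hn) as [z2 [s2 [E2 L2]]].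
  exists z2, (s1 + s2). split; [|lia]. eapply exec_seq; eassumption.
Qed.

(** The extra words lie further left and are absorbed into the arbitrary tape [L]. *)
Lemma appends_more n rs rs' p g t : appends n rs p g t -> appends n (rs ++ rs') p g t.
Proof.
  intros H L out z Hn. destruct (H (lay rs' L) out z Hn) as [z' [t' [He Ht]]].
  exists z', t'. split; [|assumption]. rewrite !app_comm_cons, !lay_app. exact He.
Qed.

(** * Programs for constant words and for loops over a word *)

Fixpoint emit (c : list bool) : prog :=
  match c with [] => move_by Stay | b :: c => Seq (write (sym_of_bool b) MoveR) (emit c) end.

Lemma appends_emit n rs c : appends n rs (emit c) c (length c + 1).
Proof.
  induction c as [|b c IH].
  - apply appends_nil.
  - replace (length (b :: c) + 1) with (1 + (length c + 1)) by (simpl; lia).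
    apply (appends_seq n rs _ _ [b] c); [|exact IH].
    (* Writing a letter uses up one listed trailing blank; when there is none the list grows, which
       truncated subtraction also describes. *)
    intros L out z _. exists (z - 1), 1. split; [|lia]. apply exec_act_eq.
    cbn [lay]. rewrite rev_app_distr. destruct z as [|z]; [reflexivity|].
    cbn. rewrite Nat.sub_0_r. reflexivity.
Qed.

(* The letter being processed is overwritten by a blank, which marks the place
   to return to; its value is remembered in the control. *)
Definition foreach (j : nat) (body : bool -> prog) : prog :=
  let visit b :=
    Seq (write Blank Stay) (Seq (next_blanks (S (S j))) (Seq (body b)
      (Seq (prev_blanks (S (S j))) (write (sym_of_bool b) MoveR)))) in
  Seq (prev_blanks (S (S j))) (Seq (move_by MoveR)
    (Seq (While nonblank (If is_one (visit true) (visit false))) (next_blanks (S j)))).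

(** The loop reads [u], the leftmost word, while the body may use the words [rs] between [u] and the
    output. Each letter costs one body and two trips; the [+ 1] in the first factor pays for the
    initial and final trips. *)
Lemma appends_foreach n rs u body g t :
  (forall b, appends n rs (body b) (g b) t) ->
  appends n (rs ++ [u]) (foreach (length rs) body) (flat_map g u)
    ((length u + 1) * (t + 2 * (nav_time rs + 2 * n + 2 * length u + 4) + 4)).
Proof.
  intros Hb L out z Hn.
  (* A bound for one trip across the output, the words [rs] and the unread part of [u]. *)
  set (N := nav_time rs + 2 * n + 2 * length u + 4).
  set (j := length rs).
  set (visit b := Seq (write Blank Stay) (Seq (next_blanks (S (S j))) (Seq (body b)
      (Seq (prev_blanks (S (S j))) (write (sym_of_bool b) MoveR))))).
  assert (Hlen : forall o v, S (S j) = length (o :: rs ++ [v])).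
  { intros. simpl. rewrite length_app. simpl. unfold j. lia. }
  assert (Hnav : forall o v, length o <= n -> length v <= length u ->
    nav_time (o :: rs ++ [v]) <= N).
  { intros o v Ho Hv. pose proof (nav_time_app rs [v]) as H. simpl in *. unfold N. lia. }
  (* Loop invariant: the letters already visited are in [l], the unread ones [v] lie at and to the
     right of the head, and [o] is the output so far. *)
  assert (Hloop : forall v o l z0 c r0, length v <= length u -> length (o ++ flat_map g v) <= n ->
    c :: r0 = syms v ++ Blank :: lay_right (o :: rs) (repeat Blank z0) ->
    exists z1 t1,
      exec (While nonblank (If is_one (visit true) (visit false))) (l, c, r0)
        (syms (rev v) ++ l, Blank, lay_right ((o ++ flat_map g v) :: rs) (repeat Blank z1)) t1
      /\ t1 <= length v * (t + 2 * N + 4) + 1).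
  { induction v as [|b v IH]; intros o l z0 c r0 Hv Ho E.
    - simpl in E. injection E as -> ->. exists z0, 1. simpl flat_map. rewrite app_nil_r.
      split; [|lia]. constructor. reflexivity.
    - simpl in E, Ho, Hv. injection E as -> ->.
      assert (Ho' : length (o ++ g b) <= n) by (rewrite !length_app in *; lia).
      (* The blank marking the visited letter closes the word [v], so for the body everything left
         of [rs] is the tape [lay [v] l]. *)
      destruct (Hb b (lay [v] l) o z0 Ho') as [z1 [t1 [E1 T1]]].
      assert (Hv1 : exists c1 r1,
        c1 :: r1 = syms v ++ Blank :: lay_right ((o ++ g b) :: rs) (repeat Blank z1)).
      { destruct (syms v ++ _) as [|c1 r1] eqn:E; [destruct v; discriminate|eauto]. }
      destruct Hv1 as [c1 [r1 Hc]].
      destruct (IH (o ++ g b) (sym_of_bool b :: l) z1 c1 r1) as [z2 [t2 [E2 T2]]];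
        [lia|rewrite !length_app in *; lia|exact Hc|].
      assert (Hvisit : exec (visit b) (l, sym_of_bool b, syms v ++ Blank :: lay_right (o :: rs) (repeat Blank z0))
         (sym_of_bool b :: l, c1, r1)
         (1 + (nav_time (o :: rs ++ [v]) + (t1 + (nav_time ((o ++ g b) :: rs ++ [v]) + 1))))).
      { eapply exec_seq; [apply exec_act_eq; reflexivity|].
        eapply exec_seq.
        { pose proof (exec_next_blanks (o :: rs ++ [v]) (S (S j)) l (repeat Blank z0) (Hlen _ _)) as H.
          rewrite app_comm_cons, lay_right_app in H. exact H. }
        eapply exec_seq.
        { rewrite lay_app. exact E1. }
        eapply exec_seq.
        { pose proof (exec_prev_blanks ((o ++ g b) :: rs ++ [v]) (S (S j)) l (repeat Blank z1) (Hlen _ _)) as H.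
          rewrite app_comm_cons, lay_right_app, lay_app in H. exact H. }
        apply exec_act_eq. cbn [lay_right]. cbn [lay_right] in Hc. rewrite <- Hc. reflexivity. }
      pose proof (Hnav o v). pose proof (Hnav (o ++ g b) v).
      assert (length o <= n) by (rewrite !length_app in *; lia).
      exists z2. eexists. split.
      + eapply exec_while_true; [apply nonblank_sym| |].
        * destruct b; [apply exec_if_true|apply exec_if_false]; try reflexivity; exact Hvisit.
        * simpl rev. simpl flat_map. rewrite map_app, <- (app_assoc (syms (rev v))), (app_assoc o). exact E2.
      + simpl length. lia. }
  destruct (syms u ++ Blank :: lay_right (out :: rs) (repeat Blank z)) as [|c r0] eqn:E;
    [destruct u; discriminate|].
  destruct (Hloop u out (Blank :: L) z c r0) as [z1 [t1 [E1 T1]]]; auto.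
  exists z1. eexists. split.
  - eapply exec_seq; [apply exec_prev_blanks; apply Hlen|].
    eapply exec_seq.
    { apply exec_act_eq. rewrite app_comm_cons, lay_right_app.
      cbn [lay_right] in E |- *. rewrite E. reflexivity. }
    eapply exec_seq; [exact E1|].
    pose proof (exec_next_blanks ((out ++ flat_map g u) :: rs) (S j)
      (syms (rev u) ++ Blank :: L) (repeat Blank z1) eq_refl) as H.
    change (syms (rev u) ++ Blank :: L) with (lay [u] L) in H at 2.
    rewrite <- lay_app in H. exact H.
  - pose proof (Hnav out u).
    assert (length out <= n) by (rewrite length_app in Hn; lia).
    assert (nav_time ((out ++ flat_map g u) :: rs) <= N) by (simpl; unfold N; lia).
    rewrite Nat.mul_add_distr_r. lia.
Qed.

(** * Emitting a word that depends on the input *)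

(* [g r] can be appended to the output in polynomial time by a program working
   next to [K] copies of [r]; each copy is consumed by one level of loop nesting. *)
Definition emittable (K : nat) (g : list bool -> list bool) : Prop :=
  exists p time len, poly_bound time /\ poly_bound len /\
    forall r, length (g r) <= len (length r) /\
      forall n, appends n (repeat r K) p (g r) (time (length r + n)).

Lemma emittable_ext K g h : (forall r, g r = h r) -> emittable K g -> emittable K h.
Proof.
  intros E (p & t & l & Ht & Hl & H). exists p, t, l. repeat split; auto; rewrite <- E; apply H.
Qed.

Lemma emittable_const K c : emittable K (fun _ => c).
Proof.
  exists (emit c), (fun _ => length c + 1), (fun _ => length c).
  repeat split; auto using poly_bound_const. intros n. apply appends_emit.
Qed.

Lemma emittable_app K g h : emittable K g -> emittable K h -> emittable K (fun r => g r ++ h r).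
Proof.
  intros (p & t & l & Ht & Hl & H) (p' & t' & l' & Ht' & Hl' & H').
  exists (Seq p p'), (fun m => t m + t' m), (fun m => l m + l' m).
  split; [apply poly_bound_add; assumption|]. split; [apply poly_bound_add; assumption|].
  intros r. destruct (H r) as [H1 H2]. destruct (H' r) as [H1' H2']. split.
  - rewrite length_app. lia.
  - intros n. apply appends_seq; auto.
Qed.

Lemma emittable_more j K g : j <= K -> emittable j g -> emittable K g.
Proof.
  intros HK (p & t & l & Ht & Hl & H). exists p, t, l. repeat split; auto; [apply H|].
  intros n. replace K with (j + (K - j)) by lia. rewrite repeat_app. apply appends_more, H.
Qed.

Lemma nav_time_repeat r k : nav_time (repeat r k) = k * (2 * length r + 2) + 1.
Proof. induction k as [|k IH]; simpl in *; lia. Qed.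

(** The loop runs over the leftmost of the [S j] copies and leaves the other [j] to the body. In the
    time bound, [m] stands for [length r + n] and dominates both summands. *)
Lemma emittable_foreach j g : (forall b, emittable j (g b)) ->
  emittable (S j) (fun r => flat_map (fun b => g b r) r).
Proof.
  intros H.
  destruct (H true) as (p1 & t1 & l1 & Ht1 & Hl1 & H1).
  destruct (H false) as (p0 & t0 & l0 & Ht0 & Hl0 & H0).
  exists (foreach j (fun b : bool => if b then p1 else p0)),
    (fun m => (m + 1) * ((t1 m + t0 m) + 2 * (j * (2 * m + 2) + 1 + 2 * m + 2 * m + 4) + 4)),
    (fun m => m * (l1 m + l0 m)).
  split; [|split].
  - repeat first [apply poly_bound_add | apply poly_bound_mul]; 
      auto using poly_bound_const, poly_bound_id.
  - repeat first [apply poly_bound_add | apply poly_bound_mul]; 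
      auto using poly_bound_const, poly_bound_id.
  - intros r. destruct (H1 r) as [L1 A1]. destruct (H0 r) as [L0 A0]. split.
    + assert (Hg : forall u, length (flat_map (fun b => g b r) u)
        <= length u * (l1 (length r) + l0 (length r))).
      { induction u as [|b u IH]; simpl; [lia|]. rewrite length_app. destruct b; lia. }
      apply Hg.
    + intros n. replace (S j) with (j + 1) by lia. rewrite repeat_app.
      set (m := length r + n).
      apply appends_le with ((length r + 1) * ((t1 m + t0 m)
        + 2 * (nav_time (repeat r j) + 2 * n + 2 * length r + 4) + 4)).
      * pose proof (appends_foreach n (repeat r j) r (fun b : bool => if b then p1 else p0)
          (fun b => g b r) (t1 m + t0 m)) as HF.
        rewrite repeat_length in HF. apply HF.
        intros [|]; [apply appends_le with (t1 m)|apply appends_le with (t0 m)];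
          try apply A1; try apply A0; lia.
      * rewrite nav_time_repeat. apply Nat.mul_le_mono; [unfold m; lia|].
        assert (j * (2 * length r + 2) <= j * (2 * m + 2))
          by (apply Nat.mul_le_mono_l; unfold m; lia).
        unfold m in *; lia.
Qed.

Definition rep {A} (c : list A) (n : nat) : list A := concat (repeat c n).

Lemma rep_add {A} (c : list A) n m : rep c (n + m) = rep c n ++ rep c m.
Proof. unfold rep. rewrite repeat_app, concat_app. reflexivity. Qed.

Lemma rep_mul {A} (c : list A) n m : rep c (n * m) = rep (rep c n) m.
Proof.
  rewrite Nat.mul_comm. induction m as [|m IH]; [reflexivity|].
  simpl. rewrite rep_add, IH. reflexivity.
Qed.

Lemma flat_map_const {A B} (c : list B) (r : list A) : flat_map (fun _ => c) r = rep c (length r).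
Proof. induction r as [|a r IH]; [reflexivity|]. simpl. rewrite IH. reflexivity. Qed.

(** With [j] nested loops over [r], the word [c] is written once for every [j]-tuple of
    positions. *)
Lemma emittable_pow j c : emittable j (fun r => rep c (length r ^ j)).
Proof.
  induction j as [|j IH].
  - apply emittable_ext with (fun _ => c); [|apply emittable_const].
    intros r. unfold rep. simpl. rewrite app_nil_r. reflexivity.
  - apply emittable_ext with (fun r => flat_map (fun _ => rep c (length r ^ j)) r).
    + intros r. rewrite flat_map_const. simpl. rewrite (Nat.mul_comm (length r)), rep_mul.
      reflexivity.
    + apply (emittable_foreach j (fun _ r => rep c (length r ^ j))). auto.
Qed.

(** The factor [d] is absorbed into the constant word [rep c d], so only the power needs loops. *)
Lemma emittable_poly k d K c : k <= K -> emittable K (fun r => rep c (d * length r ^ k + d)).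
Proof.
  intros HK. apply emittable_ext with (fun r => rep (rep c d) (length r ^ k) ++ rep c d).
  - intros r. rewrite rep_add, rep_mul. reflexivity.
  - apply emittable_app; [|apply emittable_const].
    apply emittable_more with k; [assumption|]. apply emittable_pow.
Qed.

Lemma emittable_flat_map K c : 1 <= K -> emittable K (fun r => flat_map c r).
Proof.
  intros HK. apply emittable_more with 1; [assumption|].
  apply (emittable_foreach 0 (fun b _ => c b)). intros b. apply emittable_const.
Qed.

Lemma flat_map_single (r : list bool) : flat_map (fun b => [b]) r = r.
Proof. induction r as [|b r IH]; simpl; congruence. Qed.

(** * Copying the input and the resulting polynomial-time machine *)

Fixpoint copies (k : nat) : prog :=
  match k with
  | 0 => move_by Stay
  | S k => Seq (copies k) (Seq (foreach 0 (fun b => emit [b])) (move_by MoveR))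
  end.

Definition copy_time (n : nat) : nat := (n + 1) * (1 + 1 + 2 * (1 + 2 * n + 2 * n + 4) + 4) + 1.

(** Each round copies [r] into the empty output word; stepping right then turns the blank under the
    head into the separator of a new empty output. *)
Lemma exec_copies r k : exists z t,
  exec (copies k) (lay [[]; r] [], Blank, []) (lay ([] :: repeat r (S k)) [], Blank, repeat Blank z) t
  /\ t <= k * copy_time (length r) + 1.
Proof.
  induction k as [|k (z & t & He & Ht)].
  - exists 0, 1. split; [|lia]. apply exec_act_eq. reflexivity.
  - assert (Ha : appends (length r) (repeat r (S k)) (foreach 0 (fun b => emit [b]))
      r ((length r + 1) * (1 + 1 + 2 * (1 + 2 * length r + 2 * length r + 4) + 4))).
    { change (repeat r (S k)) with ([r] ++ repeat r k). apply appends_more.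
      pose proof (appends_foreach (length r) [] r (fun b => emit [b]) (fun b => [b]) (1 + 1)) as HF.
      rewrite flat_map_single in HF. apply HF.
      intros b. apply (appends_emit _ _ [b]). }
    destruct (Ha [] [] z (le_n _)) as (z' & t' & He' & Ht').
    exists (z' - 1), (t + (t' + 1)). split.
    + eapply exec_seq; [exact He|]. eapply exec_seq; [exact He'|].
      apply exec_act_eq. destruct z' as [|z']; [reflexivity|].
      cbn. rewrite Nat.sub_0_r. reflexivity.
    + unfold copy_time at 1. simpl Nat.mul at 1. unfold copy_time in *. lia.
Qed.

Definition first_sym (w : list bool) : sym :=
  match w with [] => Blank | b :: _ => sym_of_bool b end.

Lemma init_cfg M w : init M w = Cfg (q_start M) [] (first_sym w) (syms (tl w)).
Proof. destruct w; reflexivity. Qed.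

(* The first letter is kept in the control; the blank replacing it closes the
   copy of the remaining word on the left. *)
Theorem emittable_poly_time K (g : sym -> list bool -> list bool) :
  1 <= K -> (forall x, emittable K (g x)) ->
  poly_time_computable (fun w => g (first_sym w) (tl w)).
Proof.
  intros HK H.
  assert (Hx : exists (p : sym -> prog) time len, poly_bound time /\ poly_bound len /\
    forall x r, length (g x r) <= len (length r) /\
      forall n, appends n (repeat r K) (p x) (g x r) (time (length r + n))).
  { destruct (H Blank) as (p1 & t1 & l1 & Ht1 & Hl1 & H1).
    destruct (H Zero) as (p2 & t2 & l2 & Ht2 & Hl2 & H2).
    destruct (H One) as (p3 & t3 & l3 & Ht3 & Hl3 & H3).
    exists (fun x => match x with Blank => p1 | Zero => p2 | One => p3 end),
      (fun m => t1 m + t2 m + t3 m), (fun m => l1 m + l2 m + l3 m).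
    split; [auto using poly_bound_add|]. split; [auto using poly_bound_add|].
    intros x r. split.
    - destruct x; [pose proof (proj1 (H1 r))|pose proof (proj1 (H2 r))|pose proof (proj1 (H3 r))]; lia.
    - intros n. destruct x; eapply appends_le; try apply H1; try apply H2; try apply H3; lia. }
  clear H. destruct Hx as (p & time & len & Ptime & Plen & Hp).
  set (main x := Seq (write Blank Stay) (Seq next_blank (Seq (move_by MoveR)
    (Seq (copies (K - 1)) (Seq (p x) (Seq prev_blank (move_by MoveR))))))).
  set (whole := If is_one (main One) (If nonblank (main Zero) (main Blank))).
  (* [time] and [len] need not be monotone, but the program runs on the tail while its time is
     measured in the whole input; they are replaced by monotone polynomials. *)
  destruct Ptime as [k [d Htime]]. destruct Plen as [k' [d' Hlen]].
  set (len' m := d' * m ^ k' + d').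
  set (time' m := d * (m + len' m) ^ k + d).
  assert (Plen' : poly_bound len') by (exists k', d'; intros; unfold len'; lia).
  assert (Ptime' : poly_bound time').
  { unfold time'. apply poly_bound_add; [apply poly_bound_mul|]; auto using poly_bound_const.
    apply poly_bound_pow, poly_bound_add; auto using poly_bound_id. }
  exists (machine whole), (fun n => 2 + (1 + ((2 * n + 2) + (1 + (((K - 1) * copy_time n + 1)
     + (time' n + ((2 * len' n + 2) + 1))))))).
  split; [apply machine_wf|]. split.
  { unfold copy_time.
    repeat first [exact Plen' | exact Ptime' | apply poly_bound_const | apply poly_bound_id
      | apply (poly_bound_add (fun _ => _)) | apply poly_bound_mul | apply poly_bound_add]. }
  intros w. set (x := first_sym w). set (r := tl w). set (out := g x r).
  assert (Hr : length r <= length w) by (unfold r; destruct w; simpl; lia).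
  destruct (Hp x r) as [Hl Happ]. fold out in Hl, Happ.
  specialize (Happ (length out)).
  destruct (exec_copies r (K - 1)) as (z & t1 & E1 & T1).
  replace (S (K - 1)) with K in E1 by lia.
  destruct (Happ [] [] z (le_n _)) as (z' & t2 & E2 & T2).
  assert (Hout : exists c r0, c :: r0 = syms out ++ Blank :: repeat Blank z').
  { destruct (syms out ++ _) as [|c r0] eqn:E; [destruct out; discriminate|eauto]. }
  destruct Hout as (c & r0 & Hout).
  assert (Hmain : exec (main x) ([], x, syms r) (Blank :: lay (repeat r K) [], c, r0)
    (1 + ((2 * length r + 2) + (1 + (t1 + (t2 + ((2 * length out + 2) + 1))))))).
  { eapply exec_seq; [apply exec_act_eq; reflexivity|].
    eapply exec_seq; [apply exec_next_blank_end|].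
    eapply exec_seq; [apply exec_act_eq; reflexivity|].
    cbn [act cur fst snd]. rewrite <- map_rev.
    eapply exec_seq; [exact E1|].
    eapply exec_seq; [exact E2|].
    (* Going back to the blank before the output and one cell right puts the head on the first
       letter, where the result is read. *)
    eapply exec_seq.
    { pose proof (exec_prev_blank (rev out) (lay (repeat r K) []) Blank (repeat Blank z')) as H.
      rewrite length_rev in H. exact H. }
    rewrite rev_syms_rev, <- Hout. apply exec_act_eq. reflexivity. }
  assert (Hwhole : exists t, exec whole ([], x, syms r) (Blank :: lay (repeat r K) [], c, r0) t /\
    t <= 2 + (1 + ((2 * length r + 2) + (1 + (t1 + (t2 + ((2 * length out + 2) + 1))))))).
  { unfold whole. destruct x.
    - eexists. split; [apply exec_if_false; [reflexivity|]; apply exec_if_false; [reflexivity|exact Hmain]|lia].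
    - eexists. split; [apply exec_if_false; [reflexivity|]; apply exec_if_true; [reflexivity|exact Hmain]|lia].
    - eexists. split; [apply exec_if_true; [reflexivity|exact Hmain]|lia]. }
  destruct Hwhole as (t & Ht & Hle). exists t. split.
  - eapply Nat.le_trans; [exact Hle|].
    assert (Hlr : len' (length r) <= len' (length w)).
    { unfold len'. pose proof (Nat.pow_le_mono_l _ _ k' Hr). nia. }
    assert (Hlo : length out <= len' (length r)) by (etransitivity; [exact Hl|apply Hlen]).
    assert (Ht2 : t2 <= time' (length w)).
    { etransitivity; [exact T2|]. etransitivity; [apply Htime|]. unfold time'.
      assert (Hm : length r + length out <= length w + len' (length w)) by lia.
      pose proof (Nat.pow_le_mono_l _ _ k Hm). nia. }
    assert (Hc : copy_time (length r) <= copy_time (length w)).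
    { unfold copy_time. apply Nat.add_le_mono_r, Nat.mul_le_mono; lia. }
    pose proof (Nat.mul_le_mono_l _ _ (K - 1) Hc). lia.
  - rewrite init_cfg. fold x r.
    change (Cfg (q_start (machine whole)) [] x (syms r)) with (cfg 0 ([], x, syms r)).
    rewrite (machine_run _ _ _ _ Ht). split; [reflexivity|].
    exists (Blank :: repeat Blank z'). split; [exact Hout|].
    intros s [<-|Hs]; [reflexivity|]. eapply repeat_spec; eassumption.
Qed.

(** * The formula *)

Inductive letter : Type :=
| Delim : letter
| Plain : sym -> letter
| Head : nat -> sym -> letter.

Definition sym_code (s : sym) : nat := match s with Blank => 0 | Zero => 1 | One => 2 end.

Definition code (a : letter) : nat :=
  match a with
  | Delim => 0
  | Plain s => 1 + sym_code s
  | Head q s => 4 + (3 * q + sym_code s)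
  end.

(** The three kinds of letters occupy 0, the numbers 1 to 3, and those from 4 on, where [sym_code]
    is a base-3 digit. *)
Lemma code_inj a b : code a = code b -> a = b.
Proof.
  assert (Hs : forall s, sym_code s < 3) by (destruct s; simpl; lia).
  assert (Hi : forall s s', sym_code s = sym_code s' -> s = s')
    by (destruct s, s'; simpl; congruence).
  destruct a as [|s|q s], b as [|s'|q' s']; cbn -[Nat.mul]; intros H;
    try pose proof (Hs s); try pose proof (Hs s'); try lia; try reflexivity.
  - f_equal. apply Hi. lia.
  - assert (q = q') by lia. subst. f_equal. apply Hi. lia.
Qed.

Definition all_syms : list sym := [Blank; Zero; One].

Lemma in_all_syms s : In s all_syms.
Proof. destruct s; simpl; tauto. Qed.

Definition letters (M : TM) : list letter :=
  Delim :: map Plain all_syms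
    ++ flat_map (fun q => map (Head q) all_syms) (List.seq 0 (nstates M)).

Lemma in_letters_head M q s : In (Head q s) (letters M) <-> q < nstates M.
Proof.
  unfold letters. split.
  - intros [H|H]; [discriminate|]. apply in_app_or in H. destruct H as [H|H].
    + apply in_map_iff in H. destruct H as [? [? _]]. discriminate.
    + apply in_flat_map in H. destruct H as [q' [Hq H]]. apply in_map_iff in H.
      destruct H as [s' [E _]]. injection E as <- _. apply in_seq in Hq. lia.
  - intros Hq. right. apply in_or_app. right. apply in_flat_map. exists q. split.
    + apply in_seq. lia.
    + apply in_map, in_all_syms.
Qed.

Lemma in_letters_plain M s : In (Plain s) (letters M).
Proof. right. apply in_or_app. left. apply in_map, in_all_syms. Qed.

Definition halting (M : TM) (q : nat) : bool := orb (q =? q_acc M) (q =? q_rej M).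

Definition moving_in (M : TM) (m : move) (a : letter) : option nat :=
  match a with
  | Head q s =>
      if halting M q then None else
      match delta M q s, m with
      | (q', _, MoveL), MoveL => Some q'
      | (q', _, MoveR), MoveR => Some q'
      | _, _ => None
      end
  | _ => None
  end.

(* The letter replacing [b], with neighbours [a] and [c], in the next configuration. *)
Definition window (M : TM) (a b c : letter) : letter :=
  match b with
  | Delim => Delim
  | Plain s =>
      match moving_in M MoveR a, moving_in M MoveL c with
      | Some q, _ => Head q s
      | None, Some q => Head q s
      | None, None => Plain s
      end
  | Head q s =>
      if halting M q then b else
      match delta M q s with
      | (q', s', Stay) => Head q' s'
      | (_, s', MoveR) => Plain s'
      | (q', s', MoveL) => match a with Delim => Head q' s' | _ => Plain s' end
      end
  end.

(** * Configurations as words, and the locality of a step *)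

Definition head (c : config) : nat := length (c_left c).

(** Absolute addressing of the tape from its left end. [c_left] has the nearest cell first, hence
    the reversed index; cells beyond the lists read [Blank]. *)
Definition sym_at (c : config) (i : nat) : sym :=
  if i <? head c then nth (head c - 1 - i) (c_left c) Blank
  else nth (i - head c) (c_cur c :: c_right c) Blank.

Definition cell (c : config) (i : nat) : letter :=
  if i =? head c then Head (c_state c) (sym_at c i) else Plain (sym_at c i).

(* Cell [0] of a block is the delimiter, cell [S i] is tape cell [i]. *)
Definition block (c : config) (i : nat) : letter :=
  match i with 0 => Delim | S i => cell c i end.

Lemma sym_at_head c : sym_at c (head c) = c_cur c.
Proof. unfold sym_at. rewrite Nat.ltb_irrefl, Nat.sub_diag. reflexivity. Qed.

Ltac nat_cases :=
  repeat match goal with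
  | |- context [?a <? ?b] => destruct (Nat.ltb_spec a b)
  | |- context [?a =? ?b] => destruct (Nat.eqb_spec a b)
  end.

Lemma step_halting M c : halting M (c_state c) = true -> step M c = c.
Proof. unfold step, halting. intros ->. reflexivity. Qed.

(** In absolute addresses a step rewrites a single cell. A blank created at the right end is what
    [sym_at] read there already, and the truncated [head c - 1] is the left move that stays in cell
    0. *)
Lemma step_moving M c q' s' m :
  halting M (c_state c) = false -> delta M (c_state c) (c_cur c) = (q', s', m) ->
  c_state (step M c) = q' /\
  head (step M c) = match m with
                    | MoveL => head c - 1 | MoveR => S (head c) | Stay => head c end /\
  forall i, sym_at (step M c) i = if i =? head c then s' else sym_at c i.
Proof.
  unfold step, halting. intros -> Hd. rewrite Hd.
  destruct c as [q l u r]. unfold sym_at, head. simpl.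
  destruct m; [destruct l as [|x l]|destruct r as [|x r]|]; simpl;
    (split; [reflexivity|]); (split; [lia|]); intros i; nat_cases; subst; try lia;
    try reflexivity.
  all: try (rewrite Nat.sub_diag; reflexivity).
  all: repeat match goal with
    | |- context [match ?n with 0 => _ | S _ => _ end] => destruct n eqn:?
    end; try lia; try reflexivity.
  all: try (f_equal; lia).
  all: repeat match goal with
    | |- context [match ?n with 0 => _ | S _ => _ end] => destruct n eqn:?
    end; try lia; try reflexivity.
Qed.

(** Only the head can affect a neighbouring cell. The second alternative for [z] serves the last
    cell of a block, followed by the next delimiter: no head may be hidden behind it. *)
Lemma block_step M c i z :
  (z = cell c (S i) \/ z = Delim /\ S i <> head c) ->
  cell (step M c) i = window M (block c i) (cell c i) z.
Proof.
  intros Hz.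
  assert (HzL : moving_in M MoveL z =
    if S i =? head c then moving_in M MoveL (Head (c_state c) (c_cur c)) else None).
  { destruct Hz as [->|[-> Hi]].
    - unfold cell. destruct (Nat.eqb_spec (S i) (head c)) as [->|_]; [|reflexivity].
      rewrite sym_at_head. reflexivity.
    - apply Nat.eqb_neq in Hi. rewrite Hi. reflexivity. }
  assert (HaR : moving_in M MoveR (block c i) =
    if i =? S (head c) then moving_in M MoveR (Head (c_state c) (c_cur c)) else None).
  { destruct i as [|i]; [reflexivity|]. simpl. unfold cell.
    destruct (Nat.eqb_spec i (head c)) as [->|_]; [|reflexivity].
    rewrite sym_at_head. reflexivity. }
  unfold cell at 2. unfold window.
  destruct (halting M (c_state c)) eqn:Hh.
  - rewrite step_halting by assumption. unfold cell.
    destruct (i =? head c); [rewrite ?Hh; reflexivity|].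
    rewrite HaR, HzL. cbn [moving_in]. rewrite Hh.
    destruct (i =? S (head c)), (S i =? head c); reflexivity.
  - destruct (delta M (c_state c) (c_cur c)) as [[q' s'] m] eqn:Hd.
    destruct (step_moving M c q' s' m Hh Hd) as (Eq & Eh & Es).
    unfold cell. rewrite Eq, Eh, Es.
    destruct (Nat.eqb_spec i (head c)) as [->|Hi].
    + rewrite sym_at_head, Hh, Hd.
      destruct m; nat_cases; try lia; try reflexivity.
      (* A left move in cell 0 leaves the head there; the delimiter as left neighbour tells [window]
         so. *)
      * replace (head c) with 0 by lia. reflexivity.
      * destruct (head c) as [|h] eqn:E; [lia|]. simpl. unfold cell.
        destruct (h =? head c); reflexivity.
    + rewrite HaR, HzL. cbn [moving_in]. rewrite Hh, Hd.
      destruct m; nat_cases; subst; try lia; try reflexivity.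
Qed.

(** * Formulas for words, transitions and computations *)

Fixpoint nexts (n : nat) (a : tht) : tht :=
  match n with 0 => a | S n => Next (nexts n a) end.

Fixpoint disj (l : list tht) : tht :=
  match l with [] => Bot | a :: l => Or a (disj l) end.

Fixpoint spell (l : list letter) (a : tht) : tht :=
  match l with [] => a | x :: l => And (Atom (code x)) (Next (spell l a)) end.

Lemma sat_nexts H T n : forall i a, sat H T i (nexts n a) <-> sat H T (i + n) a.
Proof.
  induction n as [|n IH]; intros i a; simpl.
  - rewrite Nat.add_0_r. reflexivity.
  - rewrite IH, Nat.add_succ_comm. reflexivity.
Qed.

Lemma sat_disj H T i l : sat H T i (disj l) <-> exists a, In a l /\ sat H T i a.
Proof.
  induction l as [|b l IH]; simpl; [firstorder|]. rewrite IH. firstorder congruence.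
Qed.

Lemma sat_spell H T a l : forall i, sat H T i (spell l a) <->
  (forall j, j < length l -> H (i + j) (code (nth j l Delim)) = true) /\ sat H T (i + length l) a.
Proof.
  induction l as [|x l IH]; intros i; simpl.
  - rewrite Nat.add_0_r. split; [intros Ha; split; [lia|exact Ha]|tauto].
  - rewrite IH, Nat.add_succ_comm. split.
    + intros (Hx & Hl & Ha). split; [|exact Ha]. intros [|j] Hj.
      * rewrite Nat.add_0_r. exact Hx.
      * rewrite <- Nat.add_succ_comm. apply Hl. lia.
    + intros (Hl & Ha). split; [|split; [|exact Ha]].
      * specialize (Hl 0). rewrite Nat.add_0_r in Hl. apply Hl. lia.
      * intros j Hj. rewrite Nat.add_succ_comm. apply (Hl (S j)). lia.
Qed.

Definition some_letter (M : TM) : tht := disj (map (fun a => Atom (code a)) (letters M)).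

Definition clash (M : TM) : tht :=
  disj (map (fun ab => And (Atom (code (fst ab))) (Atom (code (snd ab))))
    (filter (fun ab => negb (code (fst ab) =? code (snd ab)))
      (list_prod (letters M) (letters M)))).

Definition triples (M : TM) : list (letter * letter * letter) :=
  list_prod (list_prod (letters M) (letters M)) (letters M).

(** Evaluated at [i], the window is centred at [i + 1], so the new letter is demanded at
    [i + 1 + L]. *)
Definition window_formula (M : TM) (L : nat) (abc : letter * letter * letter) : tht :=
  let '(a, b, c) := abc in
  And (Atom (code a)) (Next (And (Atom (code b))
    (And (Next (Atom (code c))) (nexts L (Atom (code (window M a b c))))))).

Definition transition (M : TM) (L : nat) : tht :=
  disj (map (window_formula M L) (triples M)).

Definition accepting (M : TM) : tht :=
  disj (map (fun s => Atom (code (Head (q_acc M) s))) all_syms).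

Definition first_block (M : TM) (x : sym) (r : list bool) (pad : nat) : list letter :=
  Delim :: Head (q_start M) x :: map (fun b => Plain (sym_of_bool b)) r ++ repeat (Plain Blank) pad.

(** The first window is centred at position 1, so the transitions never produce the delimiter that
    opens the second block; it is spelled out after the first one. *)
Definition computation (M : TM) (x : sym) (r : list bool) (pad : nat) : tht :=
  And (spell (first_block M x r pad) (Atom (code Delim)))
      (Until (transition M (2 + length r + pad)) (accepting M)).

Definition reduction (M : TM) (x : sym) (r : list bool) (pad : nat) : tht :=
  And (Glob (some_letter M)) (Glob (Fin (Or (clash M) (computation M x r pad)))).

Lemma sat_some_letter M H T i :
  sat H T i (some_letter M) <-> exists a, In a (letters M) /\ H i (code a) = true.
Proof.
  unfold some_letter. rewrite sat_disj. split.
  - intros (p & Hp & Hs). apply in_map_iff in Hp. destruct Hp as (a & <- & Ha). eauto.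
  - intros (a & Ha & Hs). exists (Atom (code a)). split; [apply (in_map (fun a => Atom (code a))); exact Ha|exact Hs].
Qed.

Lemma sat_clash M H T i : sat H T i (clash M) <-> exists a b,
  In a (letters M) /\ In b (letters M) /\ a <> b /\ H i (code a) = true /\ H i (code b) = true.
Proof.
  unfold clash. rewrite sat_disj. split.
  - intros (p & Hp & Hs). apply in_map_iff in Hp. destruct Hp as ([a b] & <- & Hab).
    apply filter_In in Hab. destruct Hab as [Hab Hn]. apply in_prod_iff in Hab.
    exists a, b. simpl in *. destruct (Nat.eqb_spec (code a) (code b)); [discriminate|].
    repeat split; try tauto. congruence.
  - intros (a & b & Ha & Hb & Hn & Hs).
    exists (And (Atom (code a)) (Atom (code b))). split; [|exact Hs].
    apply in_map_iff. exists (a, b). split; [reflexivity|]. apply filter_In. split.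
    + apply in_prod; assumption.
    + simpl. destruct (Nat.eqb_spec (code a) (code b)) as [E|]; [|reflexivity].
      destruct Hn. apply code_inj. exact E.
Qed.

Lemma sat_transition M L H T i : sat H T i (transition M L) <-> exists a b c,
  (In a (letters M) /\ In b (letters M) /\ In c (letters M)) /\
  H i (code a) = true /\ H (S i) (code b) = true /\ H (S (S i)) (code c) = true /\
  H (S i + L) (code (window M a b c)) = true.
Proof.
  unfold transition. rewrite sat_disj. split.
  - intros (p & Hp & Hs). apply in_map_iff in Hp. destruct Hp as ([[a b] c] & <- & Habc).
    unfold triples in Habc. rewrite !in_prod_iff in Habc.
    exists a, b, c. simpl in Hs. rewrite sat_nexts in Hs. tauto.
  - intros (a & b & c & Habc & Hs). exists (window_formula M L (a, b, c)). split.
    + apply in_map. unfold triples. rewrite !in_prod_iff. tauto.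
    + simpl. rewrite sat_nexts. tauto.
Qed.

Lemma sat_accepting M H T i :
  sat H T i (accepting M) <-> exists s, H i (code (Head (q_acc M) s)) = true.
Proof.
  unfold accepting. rewrite sat_disj. split.
  - intros (p & Hp & Hs). apply in_map_iff in Hp. destruct Hp as (s & <- & _). eauto.
  - intros (s & Hs). exists (Atom (code (Head (q_acc M) s))). split; [|exact Hs].
    apply (in_map (fun s => Atom (code (Head (q_acc M) s)))), in_all_syms.
Qed.

(** * Correctness *)

Section Simulation.

Variables (M : TM) (x : sym) (r : list bool) (pad : nat).

Let L : nat := 2 + length r + pad.
Let c0 : config := Cfg (q_start M) [] x (syms r).
Hypothesis HM : TM_wf M.
Hypothesis Hspace : forall t, space (run M t c0) < L.

Definition history (j : nat) : letter := block (run M (j / L) c0) (j mod L).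

Lemma history_eq a i : i < L -> history (a * L + i) = block (run M a c0) i.
Proof.
  intros Hi. unfold history. rewrite (Nat.add_comm (a * L)).
  rewrite Nat.div_add, Nat.Div0.mod_add by (unfold L; lia).
  rewrite Nat.div_small, Nat.mod_small by exact Hi. reflexivity.
Qed.

Lemma run_step t c : run M (S t) c = step M (run M t c).
Proof. reflexivity. Qed.

(** The centre is a delimiter, the last cell of a block, or an inner cell. Delimiters reproduce
    themselves and the other two cases are [block_step]. *)
Lemma history_step j :
  history (S j + L) = window M (history j) (history (S j)) (history (S (S j))).
Proof.
  pose proof (Nat.div_mod_eq (S j) L) as E.
  pose proof (Nat.mod_upper_bound (S j) L) as Hi.
  set (a := S j / L) in *. set (i := S j mod L) in *.
  assert (HL : 2 <= L) by (unfold L; lia).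
  specialize (Hi ltac:(lia)).
  replace (S j + L) with (S a * L + i) by lia.
  replace (history (S j)) with (history (a * L + i)) by (f_equal; lia).
  rewrite !history_eq by assumption.
  destruct i as [|i]; [reflexivity|].
  replace (history j) with (history (a * L + i)) by (f_equal; lia).
  rewrite history_eq by lia. rewrite run_step. apply block_step.
  destruct (Nat.eq_dec (S (S i)) L) as [Hl|Hl].
  (* In the last cell the right neighbour opens the next block, and [Hspace] keeps the head from
     lying beyond. *)
  - right. split.
    + replace (S (S j)) with (S a * L + 0) by lia. rewrite history_eq by lia. reflexivity.
    + pose proof (Hspace a) as Hs. unfold space in Hs. unfold head. lia.
  - left. replace (S (S j)) with (a * L + S (S i)) by lia. rewrite history_eq by lia. reflexivity.
Qed.

Lemma run_state_bound t : c_state (run M t c0) < nstates M.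
Proof.
  destruct HM as (Hs & _ & _ & _ & Hd). induction t as [|t IH]; [exact Hs|].
  rewrite run_step. destruct (halting M (c_state (run M t c0))) eqn:Hh.
  - rewrite step_halting; assumption.
  - destruct (delta M (c_state (run M t c0)) (c_cur (run M t c0))) as [[q' s'] m] eqn:E.
    destruct (step_moving M _ q' s' m Hh E) as (-> & _).
    specialize (Hd _ (c_cur (run M t c0)) IH). rewrite E in Hd. exact Hd.
Qed.

Lemma history_letters j : In (history j) (letters M).
Proof.
  unfold history, block. destruct (j mod L); [left; reflexivity|].
  unfold cell. destruct (_ =? _).
  - apply in_letters_head, run_state_bound.
  - apply in_letters_plain.
Qed.

Lemma length_first_block : length (first_block M x r pad) = L.
Proof. unfold first_block, L. simpl. rewrite length_app, length_map, repeat_length. lia. Qed.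

Lemma nth_first_block j : j < L -> nth j (first_block M x r pad) Delim = history j.
Proof.
  intros Hj. pose proof (history_eq 0 j Hj) as E. simpl Nat.mul in E. simpl Nat.add in E.
  rewrite E. destruct j as [|[|j]]; [reflexivity|reflexivity|].
  cbn. unfold cell, sym_at, head. cbn.
  destruct (Nat.lt_ge_cases j (length r)) as [H|H].
  - rewrite app_nth1 by (rewrite length_map; exact H).
    rewrite (nth_indep _ _ (Plain (sym_of_bool true))) by (rewrite length_map; exact H).
    rewrite (nth_indep _ Blank (sym_of_bool true)) by (rewrite length_map; exact H).
    rewrite (map_nth (fun b => Plain (sym_of_bool b))), map_nth. reflexivity.
  (* Past the input, the padding letters match the default blank of [sym_at]. *)
  - rewrite app_nth2 by (rewrite length_map; exact H). rewrite length_map.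
    rewrite (nth_overflow (syms r)) by (rewrite length_map; exact H).
    rewrite (nth_indep _ _ (Plain Blank)), nth_repeat; [reflexivity|].
    rewrite repeat_length. unfold L in Hj. lia.
Qed.

Lemma history_L : history L = Delim.
Proof.
  replace L with (1 * L + 0) by lia. rewrite history_eq; [reflexivity|]. unfold L. lia.
Qed.

Lemma sat_first_block H T i :
  sat H T i (spell (first_block M x r pad) (Atom (code Delim))) <->
  forall j, j <= L -> H (i + j) (code (history j)) = true.
Proof.
  rewrite sat_spell, length_first_block. split.
  - intros [H1 H2] j Hj. destruct (Nat.eq_dec j L) as [->|Hn].
    + rewrite history_L. exact H2.
    + rewrite <- nth_first_block by lia. apply H1. lia.
  - intros H1. split.
    + intros j Hj. rewrite nth_first_block by exact Hj. apply H1. lia.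
    + change (H (i + L) (code Delim) = true). rewrite <- history_L. apply H1. lia.
Qed.

(* Where letters are unique, the transitions leave no choice. *)
Lemma computation_sound H T i :
  (forall j a b, i <= j -> In a (letters M) -> In b (letters M) ->
     H j (code a) = true -> H j (code b) = true -> a = b) ->
  sat H T i (computation M x r pad) -> exists t, c_state (run M t c0) = q_acc M.
Proof.
  intros Huniq [Hfirst Huntil]. rewrite sat_first_block in Hfirst.
  fold L in Huntil. destruct Huntil as (k & Hk & Hacc & Htr).
  (* The word agrees with [history] up to distance [n + L]. Since [L >= 2], the next window lies in
     this known part, so uniqueness identifies its three letters and [history_step] supplies the new
     one. *)
  assert (Hfollow : forall n, i + n <= k -> forall j, j <= n + L -> H (i + j) (code (history j)) = true).
  { induction n as [|n IH]; intros Hn j Hj; [apply Hfirst; lia|].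
    destruct (Nat.eq_dec j (S n + L)) as [->|Hne]; [|apply IH; lia].
    specialize (Htr (i + n)). rewrite sat_transition in Htr.
    destruct Htr as (a & b & c & (Ia & Ib & Ic) & Ha & Hb & Hc & Hd); try lia.
    rewrite <- Nat.add_succ_r in Hb. rewrite <- !Nat.add_succ_r in Hc.
    assert (HL : 2 <= L) by (unfold L; lia).
    assert (Ea : a = history n) by (apply (Huniq (i + n)); auto using history_letters; [lia|apply IH; lia]).
    assert (Eb : b = history (S n)) by (apply (Huniq (i + S n)); auto using history_letters; [lia|apply IH; lia]).
    assert (Ec : c = history (S (S n))) by (apply (Huniq (i + S (S n))); auto using history_letters; [lia|apply IH; lia]).
    subst a b c. rewrite history_step.
    replace (i + (S n + L)) with (S (i + n) + L) by lia. exact Hd. }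
  rewrite sat_accepting in Hacc. destruct Hacc as [s Hs].
  set (n := k - i).
  assert (Hn : H k (code (history n)) = true).
  { replace k with (i + n) at 1 by (unfold n; lia). apply (Hfollow n); unfold n; lia. }
  assert (E : history n = Head (q_acc M) s).
  { apply (Huniq k); auto using history_letters.
    apply in_letters_head. apply HM. }
  exists (n / L). unfold history, block, cell in E.
  destruct (n mod L); [discriminate|]. destruct (_ =? _); [|discriminate]. congruence.
Qed.

(* Infinitely many clashes can always be thinned out, so an equilibrium model has
   a clash-free suffix, on which a computation starts. *)
Lemma reduction_sound T :
  equilibrium_model T (reduction M x r pad) -> exists t, c_state (run M t c0) = q_acc M.
Proof.
  intros [[Hsome Hinf] Hmin].
  assert (Hfin : exists n, forall j, n <= j -> ~ sat T T j (clash M)).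
  { apply NNPP. intros Hno.
    assert (Hclash : forall n, exists j, n <= j /\ sat T T j (clash M)).
    { intros n. apply NNPP. intros H. apply Hno. exists n. intros j Hj Hs. apply H. eauto. }
    destruct (Hclash 0) as (i & _ & Hi). rewrite sat_clash in Hi.
    destruct Hi as (a & b & Ia & Ib & Hab & Ha & Hb).
    (* One of the two clashing letters at time [i] is dropped; [b] still satisfies [some_letter]
       there. *)
    set (H := fun j p => if andb (j =? i) (p =? code a) then false else T j p).
    apply (Hmin H).
    - intros j p. unfold H. destruct (andb _ _); congruence.
    - exists i, (code a). unfold H. rewrite !Nat.eqb_refl. simpl. congruence.
    - split.
      + intros j Hj. specialize (Hsome j Hj). rewrite sat_some_letter in Hsome |- *.
        destruct Hsome as (d & Id & Hd). unfold H.
        destruct (Nat.eqb_spec j i) as [->|]; cbn [andb]; [|eauto].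
        exists b. split; [exact Ib|].
        destruct (Nat.eqb_spec (code b) (code a)) as [E|]; [|exact Hb].
        apply code_inj in E. congruence.
      (* A clash strictly after [i] is unaffected by the removal. *)
      + intros n _. destruct (Hclash (n + S i)) as (j & Hj & Hc).
        exists j. split; [lia|]. left. rewrite sat_clash in Hc |- *.
        unfold H. destruct (Nat.eqb_spec j i); [lia|]. exact Hc. }
  destruct Hfin as [n Hn]. destruct (Hinf n (Nat.le_0_l n)) as (i & Hi & [Hc|Hc]).
  - destruct (Hn i Hi Hc).
  - apply (computation_sound T T i); [|exact Hc].
    intros j a b Hj Ia Ib Ha Hb. apply NNPP. intros Hab.
    apply (Hn j); [lia|]. rewrite sat_clash. exists a, b. auto.
Qed.

Lemma reduction_complete t :
  c_state (run M t c0) = q_acc M -> exists T, equilibrium_model T (reduction M x r pad).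
Proof.
  (* One period holds the configurations 0 to [t] and one more block, so that every transition
     before acceptance refers to letters within the period. *)
  intros Hacc. set (P := L * (t + 2)).
  set (T := fun i p => p =? code (history (i mod P))).
  assert (HL : 2 <= L) by (unfold L; lia).
  assert (HP : L + L <= P) by (unfold P; nia).
  assert (HT : forall m i, i < P -> T (m * P + i) (code (history i)) = true).
  { intros m i Hi. unfold T. rewrite (Nat.add_comm (m * P)), Nat.Div0.mod_add.
    rewrite Nat.mod_small by exact Hi. apply Nat.eqb_refl. }
  exists T. split; [split|].
  - intros j _. rewrite sat_some_letter. exists (history (j mod P)).
    split; [apply history_letters|]. unfold T. apply Nat.eqb_refl.
  - intros m _. exists (m * P). split; [nia|]. right. split.
    + rewrite sat_first_block. intros j Hj. apply HT. lia.
    + set (h := head (run M t c0)).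
      assert (Hh : S h < L).
      { pose proof (Hspace t) as Hs. unfold space in Hs. unfold h, head. lia. }
      exists (m * P + (t * L + S h)). split; [lia|]. split.
      * rewrite sat_accepting. exists (sym_at (run M t c0) h).
        rewrite <- Hacc.
        replace (Head (c_state (run M t c0)) (sym_at (run M t c0) h)) with (history (t * L + S h)).
        -- apply HT. unfold P. nia.
        -- rewrite history_eq by exact Hh. simpl. unfold cell, h.
           rewrite Nat.eqb_refl. reflexivity.
      * intros j Hj1 Hj2. fold L. rewrite sat_transition. set (i := j - m * P).
        assert (Hi : S i + L < P) by (unfold P, i; nia).
        replace j with (m * P + i) by (unfold i; lia).
        exists (history i), (history (S i)), (history (S (S i))).
        rewrite <- history_step. rewrite <- !Nat.add_succ_r, <- Nat.add_assoc.
        repeat split; try apply history_letters; apply HT; lia.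
  (* Minimality: [T] has exactly one atom at each time, and [some_letter] forces [H] to keep it. *)
  - intros H Hbelow (i & p & Hne) [Hsome _]. apply Hne.
    destruct (T i p) eqn:E.
    + specialize (Hsome i (Nat.le_0_l i)). rewrite sat_some_letter in Hsome.
      destruct Hsome as (a & _ & Ha). pose proof (Hbelow _ _ Ha) as Ha'.
      unfold T in E, Ha'. apply Nat.eqb_eq in E, Ha'. congruence.
    + destruct (H i p) eqn:E'; [|reflexivity]. apply Hbelow in E'. congruence.
Qed.

End Simulation.

(** * The reduction contains no implication *)

Lemma impl_free_disj l : (forall a, In a l -> impl_free a) -> impl_free (disj l).
Proof. induction l as [|a l IH]; simpl; intros H; [exact I|]. split; auto. Qed.

Lemma impl_free_nexts n a : impl_free a -> impl_free (nexts n a).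
Proof. intros Ha. induction n; simpl; auto. Qed.

Lemma impl_free_spell l a : impl_free a -> impl_free (spell l a).
Proof. intros Ha. induction l; simpl; auto. Qed.

Lemma impl_free_reduction M x r pad : impl_free (reduction M x r pad).
Proof.
  assert (Hmap : forall A (f : A -> tht) l, (forall a, impl_free (f a)) -> impl_free (disj (map f l))).
  { intros A f l Hf. apply impl_free_disj. intros a Ha. apply in_map_iff in Ha.
    destruct Ha as (b & <- & _). apply Hf. }
  split; [apply Hmap; simpl; auto|]. split; [apply Hmap; simpl; auto|].
  split; [apply impl_free_spell; exact I|]. split; [|apply Hmap; simpl; auto].
  apply Hmap. intros [[a b] c]. cbn. repeat split. apply impl_free_nexts. exact I.
Qed.

(** * The encoding *)

Lemma enc_nexts n a : enc (nexts n a) = rep [false; true; false; true] n ++ enc a.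
Proof. induction n as [|n IH]; simpl; [reflexivity|]. rewrite IH. reflexivity. Qed.

Definition spell_code (x : letter) : list bool :=
  [false; false; true; true] ++ enc (Atom (code x)) ++ [false; true; false; true].

Lemma enc_spell l a : enc (spell l a) = flat_map spell_code l ++ enc a.
Proof.
  induction l as [|x l IH]; [reflexivity|].
  cbn [spell enc flat_map]. rewrite IH. unfold spell_code. cbn [enc].
  rewrite <- !app_assoc. reflexivity.
Qed.

(** The list [fs] is fixed independently of [r], so a fixed sequence of programs suffices. *)
Lemma emittable_disj K (fs : list (list bool -> tht)) :
  (forall f, In f fs -> emittable K (fun r => enc (f r))) ->
  emittable K (fun r => enc (disj (map (fun f => f r) fs))).
Proof.
  induction fs as [|f fs IH]; intros H; simpl.
  - apply emittable_const.
  - apply (emittable_app K (fun _ => [false; false; true; false])); [apply emittable_const|].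
    apply emittable_app; [apply H; left; reflexivity|]. apply IH. intros; apply H; right; assumption.
Qed.

(** Only the first block and the [nexts] prefixes depend on [r]. Of the [S k] copies, [k] serve the
    power, and there is always one for a loop over [r] itself, even when [k = 0]. *)
Lemma emittable_reduction M x k d :
  emittable (S k) (fun r => enc (reduction M x r (d * length r ^ k + d))).
Proof.
  unfold reduction, computation, first_block, transition.
  assert (Hc : forall c, emittable (S k) (fun _ => c)) by (intros; apply emittable_const).
  assert (Happ : forall g h, emittable (S k) g -> emittable (S k) h ->
    emittable (S k) (fun r => g r ++ h r)) by (intros; apply emittable_app; assumption).
  assert (Htr : emittable (S k)
    (fun r => enc (disj (map (window_formula M (2 + length r + (d * length r ^ k + d))) (triples M))))).
  { apply emittable_ext with (fun r => enc (disj (map (fun f : list bool -> tht => f r)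
      (map (fun abc r => window_formula M (2 + length r + (d * length r ^ k + d)) abc) (triples M))))).
    { intros r. rewrite map_map. reflexivity. }
    apply emittable_disj. intros f Hf. apply in_map_iff in Hf.
    destruct Hf as ([[a b] c] & <- & _). cbn [window_formula enc].
    repeat (apply Happ; [apply Hc|]).
    (* The summand 2 of the block length has gone with the constant prefixes; [length r] and the
       padding remain. *)
    apply emittable_ext with (fun r => flat_map (fun _ => [false; true; false; true]) r
      ++ rep [false; true; false; true] (d * length r ^ k + d)
      ++ enc (Atom (code (window M a b c)))).
    - intros r. rewrite enc_nexts, !rep_add, flat_map_const, <- !app_assoc. reflexivity.
    - apply Happ; [apply emittable_flat_map; lia|].
      apply Happ; [apply emittable_poly; lia|apply Hc]. }
  cbn [enc].
  repeat (apply Happ; [apply Hc|]).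
  apply (Happ (fun r => enc (spell _ _))); [|apply Happ; [apply Hc|apply Happ; [exact Htr|apply Hc]]].
  apply emittable_ext with (fun r => (spell_code Delim ++ spell_code (Head (q_start M) x))
    ++ flat_map (fun b => spell_code (Plain (sym_of_bool b))) r
    ++ rep (spell_code (Plain Blank)) (d * length r ^ k + d) ++ enc (Atom (code Delim))).
  - intros r. rewrite enc_spell. cbn [flat_map]. rewrite flat_map_app, <- !app_assoc.
    do 3 f_equal.
    + rewrite !flat_map_concat_map, map_map. reflexivity.
    + f_equal. unfold rep. rewrite flat_map_concat_map, map_repeat. reflexivity.
  - apply Happ; [apply Hc|]. apply Happ; [apply emittable_flat_map; lia|].
    apply Happ; [apply emittable_poly; lia|apply Hc].
Qed.

(** * Unique readability of the encoding *)

(** [true] announces a bit and [false] ends the code, so the code is prefix-free and the suffixes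
    agree as well. *)
Lemma enc_nat_inj n m u v : enc_nat n ++ u = enc_nat m ++ v -> n = m /\ u = v.
Proof.
  assert (Hb : forall k l u v, flat_map (fun b : bool => [true; b]) k ++ false :: u
     = flat_map (fun b : bool => [true; b]) l ++ false :: v -> k = l /\ u = v).
  { induction k as [|b k IH]; intros [|b' l] u' v' H; simpl in H; try discriminate.
    - injection H as ->. auto.
    - injection H as -> H. apply IH in H. destruct H as [-> ->]. auto. }
  assert (Hp : forall p q, pbits p = pbits q -> p = q).
  { induction p; intros [q|q|]; simpl; intros H; try discriminate; try reflexivity;
      injection H as H; f_equal; auto. }
  unfold enc_nat. rewrite <- !app_assoc. intros H. apply Hb in H. destruct H as [H ->].
  apply Hp, SuccNat2Pos.inj in H. auto.
Qed.

(** The four-bit tags separate the constructors; arbitrary suffixes let the induction split the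
    codes of two consecutive subformulas. *)
Lemma enc_app_inj a : forall b u v, enc a ++ u = enc b ++ v -> a = b /\ u = v.
Proof.
  induction a; intros [] u v H; simpl in H; try discriminate;
    try rewrite <- !app_assoc in H; try (injection H as H); try (apply enc_nat_inj in H);
    repeat match goal with
    | IH : forall b u v, enc ?a ++ u = enc b ++ v -> _, H : enc ?a ++ _ = enc _ ++ _ |- _ =>
        apply IH in H; destruct H as [<- H]
    end; try (destruct H; subst); subst; auto.
Qed.

Lemma enc_inj a b : enc a = enc b -> a = b.
Proof. intros H. apply (enc_app_inj a b [] []). rewrite H. reflexivity. Qed.

Lemma run_halted M c s t : halted M (run M s c) -> s <= t -> run M t c = run M s c.
Proof.
  intros Hh Hst. replace t with (s + (t - s)) by lia. induction (t - s) as [|n IH].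
  - rewrite Nat.add_0_r. reflexivity.
  - rewrite Nat.add_succ_r, run_step, IH. apply step_halting.
    unfold halting. destruct Hh as [->| ->]; rewrite Nat.eqb_refl, ?Bool.orb_true_r; reflexivity.
Qed.

Theorem mainTheorem7 : PSPACE_hard CON_THT0.
Proof.
  intros lang (M & p & HM & (k & d & Hp) & Hdec).
  (* Chosen so that [d * (m + 1) ^ k + d <= D * m ^ k + D] for the length [m] of the tail, by
     [pow_succ_bound]. *)
  set (D := d * 2 ^ k + 2 * d).
  set (g x r := enc (reduction M x r (D * length r ^ k + D))).
  exists (fun w => g (first_sym w) (tl w)). split.
  { apply (emittable_poly_time (S k) g); [lia|]. intros x. apply emittable_reduction. }
  intros w. destruct (Hdec w) as [(t & Hhalt & Hlang) Hspace].
  rewrite init_cfg in *. set (x := first_sym w) in *. set (r := tl w) in *.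
  assert (Hbound : forall s, space (run M s (Cfg (q_start M) [] x (syms r)))
    < 2 + length r + (D * length r ^ k + D)).
  { intros s. specialize (Hspace s). specialize (Hp (length w)).
    assert (Hlw : length w <= length r + 1) by (unfold r; destruct w; simpl; lia).
    pose proof (Nat.pow_le_mono_l _ _ k Hlw). pose proof (pow_succ_bound (length r) k).
    assert (d * length w ^ k <= d * (2 ^ k * length r ^ k + 1)) by (apply Nat.mul_le_mono_l; lia).
    assert (d * 2 ^ k * length r ^ k <= D * length r ^ k) by (apply Nat.mul_le_mono_r; unfold D; lia).
    unfold D at 2. lia. }
  rewrite <- Hlang. split.
  - intros Hacc. exists (reduction M x r (D * length r ^ k + D)).
    split; [reflexivity|]. split; [apply impl_free_reduction|].
    eapply reduction_complete; eauto.
  - intros (phi & Henc & _ & T & HT). apply enc_inj in Henc. subst phi.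
    destruct (reduction_sound M x r _ HM Hbound T HT) as [s Hs].
    (* Halted configurations persist, so acceptance at time [s] and halting at time [t] give the
       same state. *)
    destruct (Nat.le_ge_cases s t) as [Hst|Hst].
    + rewrite (run_halted M _ s t); [exact Hs|left; exact Hs|exact Hst].
    + rewrite <- (run_halted M _ t s Hhalt Hst). exact Hs.
Qed.
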